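(* Let $f:\mathbb{C}\to\mathbb{C}$ be a non-constant polynomial and $c\in\mathbb{C}$. Then $\mathcal{K}_c$ is a compact subset of $\mathbb{C}$.
   Context: The sequence $(f_n)_{n\ge 0}$ is defined by $f_0(z)=z$, $f_1(z)=f(z)$, and $f_n(z)=f_{n-1}(z)f_{n-2}(z)+c$ for $n\ge 2$. The filled-in Julia set is $\mathcal{K}_c=\{z\in\mathbb{C}:\sup_{n\in\mathbb{N}}|f_n(z)|<+\infty\}$. *)

(* Defs.v *)
From HB Require Import structures.
From mathcomp Require Import all_boot all_order all_algebra.
From mathcomp Require Import all_classical all_reals all_analysis.
From mathcomp Require Import complex.

Set Implicit Arguments.
Unset Strict Implicit.
Unset Printing Implicit Defensive.

Import Order.TTheory GRing.Theory Num.Theory.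
Import numFieldNormedType.Exports.
Local Open Scope classical_set_scope.
Local Open Scope ring_scope.
Local Open Scope complex_scope.

(* The metric topology of `|z - w| is only available on R[i] seen as a
   numClosedFieldType; these instances make it the topology of the type
   complex R itself. *)
HB.instance Definition _ (R : realType) :=
  PseudoPointedMetric.copy R[i] (R[i] : numClosedFieldType)^o.
HB.instance Definition _ (R : realType) :=
  NormedModule.copy R[i] (R[i] : numClosedFieldType)^o.

Fixpoint fib_iter (R : realType) (f : {poly R[i]}) (c : R[i]) (n : nat)
    (z : R[i]) : R[i] :=
  match n with
  | 0%N => z
  | 1%N => f.[z]
  | (m.+1 as k).+1 => fib_iter f c k z * fib_iter f c m z + c
  end.

(* The norm `|z| of z : R[i] is itself an element of R[i]; Normc.normc z
   is the same modulus as an element of R. *)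
Definition filled_julia (R : realType) (f : {poly R[i]}) (c : R[i]) :
    set R[i] :=
  [set z | (ereal_sup (range (fun n : nat =>
              (Normc.normc (fib_iter f c n z))%:E)) < +oo)%E].

(* Main.v *)
(* Put r = |c| + 2. Two consecutive values of modulus > r force f_n(z) to
   diverge, because then |f_{n+2}| >= |f_{n+1}| + 2. Conversely, if no two
   consecutive values exceed r, the orbit is bounded. Hence K_c is the
   intersection over n of {|f_n| <= r} U {|f_{n+1}| <= r}, which is closed; it
   is bounded since |z| and |f(z)| both exceed r when |z| is large. *)
Require Import Defs.
From HB Require Import structures.
From mathcomp Require Import all_boot all_order all_algebra.
From mathcomp Require Import all_classical all_reals all_analysis.
From mathcomp Require Import complex.
From mathcomp Require Import lra.

Set Implicit Arguments.
Unset Strict Implicit.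
Unset Printing Implicit Defensive.

Import Order.TTheory GRing.Theory Num.Theory.
Import numFieldNormedType.Exports.
Local Open Scope classical_set_scope.
Local Open Scope ring_scope.
Local Open Scope complex_scope.

Import Normc.

Lemma complex_normE (R : realType) (z : R[i]) : `|z| = (normc z)%:C.
Proof. by case: z. Qed.

Lemma normcD_le (R : realType) (x y : R[i]) :
  normc (x + y) <= normc x + normc y.
Proof. exact: le_normcD. Qed.

Lemma normcD_ge (R : realType) (x y : R[i]) :
  normc x - normc y <= normc (x + y).
Proof.
rewrite lerBlDr -[normc y](normcN (y : Rcomplex R)).
by rewrite -[in leLHS](addrK y x); exact: normcD_le.
Qed.

Lemma normc_ge0 (R : realType) (z : R[i]) : 0 <= normc z.
Proof. by case: z => a b /=; exact: sqrtr_ge0. Qed.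

Lemma normc_ge_coord (R : realType) (a b : R) :
  `|a| <= normc (a +i* b) /\ `|b| <= normc (a +i* b).
Proof.
by split; rewrite /= -sqrtr_sqr ler_sqrt ?addr_ge0 ?sqr_ge0// (lerDl, lerDr)
  sqr_ge0.
Qed.

(** The reverse triangle inequality, used in both directions, makes [normc] 1-Lipschitz. *)
Lemma normc_continuous (R : realType) : continuous (@normc R : R[i] -> R).
Proof.
move=> z; apply/(@cvgrPdist_lt _ _ _ (nbhs z) (nbhs_filter z)) => e e0.
have e0C : 0 < e%:C by rewrite ltcR.
apply: (@filterS _ _ (nbhs_filter z) _ _ _ (nbhsx_ballx z _ e0C)) => t.
rewrite -ball_normE /= complex_normE ltcR; apply: le_lt_trans.
have ztz := normcD_ge z (t - z); have zt := normcD_ge t (z - t).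
have tz : normc (t - z) = normc (z - t).
  by rewrite -(normcN (t - z : Rcomplex R)) opprB.
move: ztz zt; rewrite !subrKC tz ler_norml => ztz zt.
by apply/andP; split; lra.
Qed.

Lemma real_complex_continuous (R : realType) :
  continuous (real_complex R : R -> R[i]).
Proof.
move=> x; apply/(@cvgrPdist_lt _ R[i]) => -[e e'] e0.
(* The order of [R[i]] compares only elements with equal imaginary parts, so a positive radius is
   real. *)
have e'0 : e' = 0 by move: e0; rewrite ltcE/= => /andP[/eqP].
rewrite e'0 in e0 *.
have e0R : 0 < e by rewrite -ltcR.
apply: filterS (nbhsx_ballx x _ e0R) => t.
rewrite -ball_normE /= complex_normE ltcR /= subr0 expr0n/= addr0.
by rewrite sqrtr_sqr.
Qed.

(** Heine-Borel is carried over from the real line: the disc is closed and lies in the image of a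
    compact square under the continuous map [h]. *)
Lemma compact_normc_le (R : realType) (M : R) :
  compact [set z : R[i] | normc z <= M].
Proof.
pose h (p : R * R) : R[i] := p.1%:C + 'i * p.2%:C.
have hE p : h p = p.1 +i* p.2 by case: p => a b; rewrite /h; simpc.
have hcont : continuous h.
  move=> p; apply: cvgD; last apply: cvgM; first 2 last.
  - apply: (cvg_comp (fun q : R * R => q.2) _ cvg_snd).
    exact: real_complex_continuous.
  - apply: (cvg_comp (fun q : R * R => q.1) _ cvg_fst).
    exact: real_complex_continuous.
  - exact: cvg_cst.
apply: (@subclosed_compact _ _ (h @` (`[- M, M] `*` `[- M, M]))).
- rewrite (_ : mkset _ = (@normc R : R[i] -> R) @^-1` [set x | x <= M]) //.
  by apply: closed_comp => [z _|]; [exact: normc_continuous|exact: closed_le].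
- apply: continuous_compact; first exact: continuous_subspaceT.
  by apply: compact_setX; exact: segment_compact.
- move=> [a b] abM /=; have [aM bM] := normc_ge_coord a b.
  exists (a, b); last by rewrite hE.
  split => /=; rewrite in_itv/= -ler_norml; exact: le_trans abM.
Qed.

Lemma complex_horner_continuous (R : realType) (p : {poly R[i]}) :
  continuous (horner p : R[i] -> R[i]).
Proof.
elim/poly_ind: p => [|p a IH] z.
  rewrite (_ : horner 0 = cst 0); last by apply/funext => w; rewrite horner0.
  exact: cst_continuous.
rewrite (_ : horner _ = fun w => p.[w] * w + a); last first.
  by apply/funext => w; rewrite hornerMXaddC.
apply: (@cvgD _ _ _ (nbhs z) (nbhs_filter z)); last exact: cst_continuous.
by apply: (@cvgM _ _ (nbhs z) (nbhs_filter z)); [exact: IH|exact: cvg_id].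
Qed.

Lemma fib_iter_continuous (R : realType) (f : {poly R[i]}) (c : R[i]) (n : nat) :
  continuous (fib_iter f c n : R[i] -> R[i]).
Proof.
(* The recursion reads two earlier values, so the induction carries two consecutive indices. *)
suff [H _] : continuous (fib_iter f c n : R[i] -> R[i]) /\
  continuous (fib_iter f c n.+1 : R[i] -> R[i]) by exact: H.
elim: n => [|n [IH IH1]]; split; last 2 first.
- exact: IH1.
- move=> z.
  apply: (@cvgD _ _ _ (nbhs z) (nbhs_filter z)); last exact: cst_continuous.
  by apply: (@cvgM _ _ (nbhs z) (nbhs_filter z)); [exact: IH1|exact: IH].
- by move=> z; exact: cvg_id.
- exact: complex_horner_continuous.
Qed.

(** Induction on the Horner form [p * 'X + a]: if [d] bounds [p] below far out, the new modulus is
    at least [d * normc z - normc a], which reaches 1 once [normc z > (1 + normc a) / d]. *)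
Lemma horner_bounded_below (R : realType) (p : {poly R[i]}) : p != 0 ->
  exists2 d : R, 0 < d & exists r, forall z, r < normc z -> d <= normc p.[z].
Proof.
elim/poly_ind: p => [|p a IH]; first by rewrite eqxx.
have [->|p0 _] := eqVneq p 0.
  rewrite mul0r add0r polyC_eq0 => a0; exists (normc a).
    by rewrite lt_def normc_ge0 andbT; apply: contra a0 => /eqP/eq0_normc ->.
  by exists 0 => z _; rewrite hornerC.
have [d d0 [r Hr]] := IH p0.
exists 1 => //; exists (Num.max r ((1 + normc a) / d)) => z.
rewrite gt_max => /andP[rz az]; rewrite hornerMXaddC.
apply: le_trans (normcD_ge _ _); rewrite normcM lerBrDr.
move: az; rewrite ltr_pdivrMr// mulrC => /ltW/le_trans; apply.
by rewrite ler_wpM2r ?normc_ge0 ?Hr.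
Qed.

(** One Horner step suffices: size above 1 makes the quotient by ['X] nonzero, hence bounded below
    far out, and the factor [z] then drives the modulus past [M]. *)
Lemma horner_escape (R : realType) (p : {poly R[i]}) (M : R) :
  (1 < size p)%N ->
  exists r : R, forall z, r < normc z -> M < normc p.[z].
Proof.
elim/poly_ind: p => [|p a _]; first by rewrite size_poly0.
rewrite size_MXaddC; case: ifP => // _; rewrite ltnS size_poly_gt0 => p0.
have [d d0 [r Hr]] := horner_bounded_below p0.
exists (Num.max r ((M + normc a) / d)) => z.
rewrite gt_max => /andP[rz az]; rewrite hornerMXaddC.
apply: lt_le_trans (normcD_ge _ _); rewrite normcM ltrBrDr.
move: az; rewrite ltr_pdivrMr// mulrC => /lt_le_trans; apply.
by rewrite ler_wpM2r ?normc_ge0 ?Hr.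
Qed.

Lemma filled_juliaP (R : realType) (f : {poly R[i]}) (c z : R[i]) :
  filled_julia f c z <->
  exists M : R, forall n, normc (fib_iter f c n z) <= M.
Proof.
rewrite /filled_julia /=; split => [fin|[M HM]]; last first.
  apply: (@le_lt_trans _ _ M%:E); last exact: ltry.
  by apply: ge_ereal_sup => _ [n _ <-]; rewrite lee_fin.
set s := ereal_sup _ in fin.
have ub n : ((normc (fib_iter f c n z))%:E <= s)%E.
  by apply: ereal_sup_ubound; exists n.
(* The supremum lies between 0 and [+oo], so its real value can serve as [M]. *)
have sfin : s \is a fin_num.
  by rewrite ge0_fin_numE //; apply: le_trans (ub 0%N); rewrite lee_fin normc_ge0.
by exists (fine s) => n; rewrite -lee_fin fineK.
Qed.

Section Threshold.
Variables (R : realType) (f : {poly R[i]}) (c z : R[i]).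
Let x n := normc (fib_iter f c n z).
Let r := normc c + 2.

Lemma fib_iter_escape n : r < x n -> r < x n.+1 -> ~ filled_julia f c z.
Proof.
move=> rn rn1.
(* Growth by 1 per step is enough: if [a] and [b] exceed [r], then [a * b - normc c >= a + a *
   (normc c + 1) - normc c >= a + 1]. *)
have grow k : r < x (n + k)%N /\ r + k%:R < x (n + k).+1.
  elim: k => [|k [IH IH1]]; first by rewrite addn0 addr0.
  rewrite addnS; have k0 : 0 <= k%:R :> R by [].
  split; first by apply: le_lt_trans IH1; rewrite lerDl.
  have := normcD_ge (fib_iter f c (n + k).+1 z * fib_iter f c (n + k) z) c.
  rewrite normcM -/(x _) -/(x _) -[normc (_ + c)]/(x (n + k).+2).
  have c0 := normc_ge0 c; rewrite /r in IH IH1 *; rewrite -natr1.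
  by nra.
move=> /filled_juliaP[M HM].
(* After [Num.bound M > M] steps the growth contradicts the bound [M]. *)
have [_ /lt_le_trans/(_ (HM _))] := grow (Num.bound M).
have := archi_boundP (le_trans (normc_ge0 _) (HM 0%N)).
have c0 := normc_ge0 c; rewrite /r; lra.
Qed.

(* If [L] dominates the earlier values and [L < x n.+2], then both neighbours of
   [x n.+2] are at most [r]; smallness of [x n.+3] bounds [L * x n.+1], and with
   it [x n.+2 <= x n.+1 * L + normc c]. *)
Lemma filled_julia_threshold :
  (forall n, x n <= r \/ x n.+1 <= r) -> filled_julia f c z.
Proof.
move=> small; apply/filled_juliaP.
have c0 := normc_ge0 c.
(* The first two terms settle the base case; [r + 2 * normc c] is the bound on [x n.+2] that [up]
   and [down] produce together. *)
pose L := x 0%N + x 1%N + r + 2 * normc c.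
have xge0 n : 0 <= x n by exact: normc_ge0.
have x00 := xge0 0%N; have x10 := xge0 1%N.
suff bnd n : x n <= L /\ x n.+1 <= L by exists L => n; have [] := bnd n.
elim: n => [|n [IH IH1]]; first by rewrite /L /r; split; lra.
split=> //; rewrite leNgt; apply/negP => Lx.
have rL : r <= L by rewrite /L; lra.
have y_small : x n.+1 <= r by case: (small n.+1) => // ?; lra.
have next_small : x n.+3 <= r by case: (small n.+2) => // ?; lra.
have up : x n.+2 <= x n.+1 * x n + normc c.
  by rewrite /x -normcM; exact: normcD_le.
have down : x n.+2 * x n.+1 - normc c <= x n.+3.
  by rewrite /x -normcM; exact: normcD_ge.
have y0 := xge0 n.+1.
have Ly : x n.+1 * L <= x n.+2 * x n.+1 by rewrite mulrC ler_wpM2r// ltW.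
have wy : x n.+1 * x n <= x n.+1 * L by rewrite ler_wpM2l.
rewrite /L in Lx Ly wy; lra.
Qed.

End Threshold.

Lemma filled_julia_closed (R : realType) (f : {poly R[i]}) (c : R[i]) :
  closed (filled_julia f c).
Proof.
pose r := normc c + 2.
pose S n := [set z : R[i] | normc (fib_iter f c n z) <= r].
have Scl n : closed (S n).
  rewrite (_ : S n =
    (fun z : R[i] => normc (fib_iter f c n z)) @^-1` [set y | y <= r]) //.
  apply: closed_comp => [z _|]; last exact: closed_le.
  apply: (@continuous_comp R[i] R[i] R); first exact: fib_iter_continuous.
  exact: normc_continuous.
rewrite (_ : filled_julia f c = \bigcap_n (S n `|` S n.+1)).
  by apply: closed_bigI => n _; exact: closedU.
apply/seteqP; split => z.
- move=> Kz n _; have [?|rn] := leP (normc (fib_iter f c n z)) r; first by left.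
  right; rewrite /S /= leNgt; apply/negP => rn1.
  exact: fib_iter_escape rn rn1 Kz.
- by move=> Sz; apply: filled_julia_threshold => n; exact: Sz.
Qed.

Theorem corollary2p5 (R : realType) (f : {poly R[i]}) (c : R[i])
    (hf : (1 < size f)%N) :
  compact (filled_julia f c).
Proof.
have [r Hr] := horner_escape (normc c + 2) hf.
(* Outside this disc [normc c + 2] makes [z] large and [r] makes [f.[z]] large, so the orbit escapes
   from index 0. *)
apply: subclosed_compact (@filled_julia_closed R f c)
  (@compact_normc_le R (Num.max r (normc c + 2))) _ => z Kz /=.
rewrite leNgt; apply/negP; rewrite gt_max => /andP[rz cz].
by apply: (@fib_iter_escape R f c z 0%N) Kz => //; exact: Hr.
Qed.
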